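(* Let $\alpha\in(0,1)$. Let $W$ be the true matrix of input-output linkages of $n$ firms with all of the data, and let $U$ be the observed matrix of the input-output linkages with data missing. Suppose that for each $i=1,\dots,n$, the missing data accounts for at most a $\delta$ share of the goods in the total intermediate input use of firm $i$, where $0\le\delta<1$. If $v_U$ denotes the influence vector calculated with the missing data and $v_W$ denotes the true influence vector, then the maximum possible value of $\|v_U-v_W\|_p$ is $\Theta(\delta)$ for all $p\ge1$, where the constants in the bound depend on $\alpha$.
   Context: An input-output linkage matrix of $n$ firms is a real $n\times n$ matrix $W=(w_{ij})$ with $w_{ij}\ge 0$, $w_{ii}=0$ and $\sum_{j=1}^n w_{ij}=1$ for all $i$; $w_{ij}$ is the share of the intermediate inputs of firm $i$ that come from firm $j$. With $W'$ the transpose of $W$ and $\vec{\mathbf 1}$ the all-ones column vector, the influence vector of $W$ (for the parameter $\alpha\in(0,1)$, the share of labor) is $v_W=\frac{\alpha}{n}(I-(1-\alpha)W')^{-1}\vec{\mathbf 1}$. Missing data: firm $i$ has total intermediate input use $\mathrm{II}_i$ (observed and missing together), of which $w_{ij}\mathrm{II}_i$ comes from firm $j$. Only amounts $x_{ij}$ with $0\le x_{ij}\le w_{ij}\mathrm{II}_i$ are observed; the rest is missing. ''The missing data accounts for at most a $\delta$ share of the total intermediate input use of firm $i$'' means that at most $\delta\,\mathrm{II}_i$ is missing, i.e. $\sum_j x_{ij}\ge(1-\delta)\mathrm{II}_i$. The observed matrix is $U=(u_{ij})$ with $u_{ij}=x_{ij}/\sum_k x_{ik}$. $\|v\|_p=(\sum_i|v_i|^p)^{1/p}$.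 For functions of $\delta\in(0,1)$, $f(\delta)=O(g(\delta))$ means that there are constants $D,K>0$ with $f(\delta)\le Kg(\delta)$ for all $\delta\in(0,D)$; $f(\delta)=\Omega(g(\delta))$ means that there are constants $D,K>0$ with $f(\delta)\ge Kg(\delta)$ for all $\delta\in(0,D)$; $f=\Theta(g)$ means both.
   Formalization: The lower bound (hence Θ(δ)) is claimed only for n≥3 firms; for n=2 the only linkage matrix is the swap, so U=W and the maximum is 0. Existence of the maximum and the O(δ) bound are claimed for n≥2; for n=1 there is no linkage matrix. *)

(* Defs.v *)
From HB Require Import structures.
From mathcomp Require Import all_boot all_order all_algebra.
From mathcomp Require Import all_classical all_reals all_analysis.

Set Implicit Arguments.
Unset Strict Implicit.
Unset Printing Implicit Defensive.

Import Order.TTheory GRing.Theory Num.Theory.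
Local Open Scope classical_set_scope.
Local Open Scope ring_scope.

Definition linkage_matrix (R : realType) (n : nat) (W : 'M[R]_n) : Prop :=
  [/\ forall i j, 0 <= W i j,
      forall i, W i i = 0
    & forall i, \sum_j W i j = 1].

(* The matrix to invert is a unit whenever 0 < alpha < 1 and the rows of W are
   probability vectors, so the junk value of invmx is never used there. *)
Definition influence (R : realType) (alpha : R) (n : nat) (W : 'M[R]_n) :
    'cV[R]_n :=
  (alpha / n%:R) *: (invmx (1%:M - (1 - alpha) *: W^T) *m const_mx 1).

(* [II i] is the total intermediate input use of firm i, and [X i j] the
   observed part of the amount [W i j * II i] that i buys from j. Positivity of
   [II i], with delta < 1, keeps the row sums of X nonzero, so that
   [observed_linkages X] involves no division by 0. *)
Definition observation (R : realType) (delta : R) (n : nat) (W : 'M[R]_n)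
    (II : 'I_n -> R) (X : 'M[R]_n) : Prop :=
  [/\ forall i, 0 < II i,
      forall i j, 0 <= X i j <= W i j * II i
    & forall i, (1 - delta) * II i <= \sum_j X i j].

Definition observed_linkages (R : realType) (n : nat) (X : 'M[R]_n) : 'M[R]_n :=
  \matrix_(i, j) (X i j / \sum_k X i k).

Definition lpnorm (R : realType) (p : R) (n : nat) (v : 'cV[R]_n) : R :=
  (\sum_i `|v i 0| `^ p) `^ p^-1.

Definition influence_errors (R : realType) (alpha p : R) (n : nat) (delta : R) :
    set R :=
  [set e | exists (W : 'M[R]_n) (II : 'I_n -> R) (X : 'M[R]_n),
     [/\ linkage_matrix W,
         observation delta W II X
       & e = lpnorm p (influence alpha (observed_linkages X)
                       - influence alpha W)]].

Definition is_maximum (R : realType) (A : set R) (m : R) : Prop :=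
  A m /\ ubound A m.

(* f = O(g) and f = Omega(g) as delta -> 0+, with the constants exposed so that
   one can say what they depend on. *)
Definition bigO_with (R : realType) (D K : R) (f g : R -> R) : Prop :=
  forall delta, 0 < delta < D -> f delta <= K * g delta.

Definition bigOmega_with (R : realType) (D K : R) (f g : R -> R) : Prop :=
  forall delta, 0 < delta < D -> K * g delta <= f delta.

(* Main.v *)
(** The influence vector solves [v = alpha / n * 1 + (1 - alpha) W^T v], and
[W^T] does not increase the l1 norm.  Hence
[|v_U - v_W|_1 <= (1 - alpha) / alpha * max_i |U_i - W_i|_1] over the rows [i],
and each row distance is at most [2 delta]; the l1 norm dominates every lp norm.
The same estimate makes [v] continuous in the matrix, so the maximum is attained
on the compact set of pairs [(W, U)] with [(1 - delta) U <= W].  For the lower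
bound with constants free of [n] and [p], n - 2 firms shift a share [delta] of
their purchases between two hubs, which moves the coordinate of a hub, and thus
every lp norm, by at least a constant times [delta]. *)

Require Import Defs.
From HB Require Import structures.
From mathcomp Require Import all_boot all_order all_algebra.
From mathcomp Require Import all_classical all_reals all_analysis.
From mathcomp Require Import ring lra zify.

Set Implicit Arguments.
Unset Strict Implicit.
Unset Printing Implicit Defensive.

Import Order.TTheory GRing.Theory Num.Theory.
Import numFieldNormedType.Exports.
Local Open Scope classical_set_scope.
Local Open Scope ring_scope.

(** * Row-stochastic matrices and the l1 norm *)

Definition stochastic (R : realType) (n : nat) (W : 'M[R]_n) : Prop :=
  (forall i j, 0 <= W i j) /\ (forall i, \sum_j W i j = 1).

Definition norm1 (R : realType) (n : nat) (v : 'cV[R]_n) : R :=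
  \sum_i `|v i 0|.

Lemma norm1_ge0 (R : realType) (n : nat) (v : 'cV[R]_n) : 0 <= norm1 v.
Proof. exact: sumr_ge0. Qed.

Lemma norm1_eq0 (R : realType) (n : nat) (v : 'cV[R]_n) :
  norm1 v <= 0 -> v = 0.
Proof.
move=> v0; have /eqP : norm1 v = 0 by apply/le_anti; rewrite v0 norm1_ge0.
rewrite psumr_eq0// => /allP h; apply/colP => i; rewrite mxE.
by apply/eqP; rewrite -normr_eq0; apply: h; rewrite mem_index_enum.
Qed.

Lemma ler_norm1D (R : realType) (n : nat) (u v : 'cV[R]_n) :
  norm1 (u + v) <= norm1 u + norm1 v.
Proof.
by rewrite -big_split ler_sum// => i _; rewrite mxE ler_normD.
Qed.

Lemma norm1Z (R : realType) (n : nat) (a : R) (v : 'cV[R]_n) :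
  norm1 (a *: v) = `|a| * norm1 v.
Proof.
by rewrite /norm1 mulr_sumr; apply: eq_bigr => i _; rewrite mxE normrM.
Qed.

(** Rows of [M] are columns of [M^T], and absolute column sums control the l1 operator norm; the
    proof swaps the two sums. *)
Lemma ler_norm1_trmul (R : realType) (n : nat) (B : R) (M : 'M[R]_n)
    (v : 'cV[R]_n) :
  (forall i, \sum_j `|M i j| <= B) -> norm1 (M^T *m v) <= B * norm1 v.
Proof.
move=> MB.
have /le_trans -> // : norm1 (M^T *m v) <= \sum_j \sum_i `|M i j| * `|v i 0|.
  apply: ler_sum => j _; rewrite mxE (le_trans (ler_norm_sum _ _ _))//.
  by apply: ler_sum => i _; rewrite mxE normrM.
rewrite exchange_big/= /norm1 mulr_sumr; apply: ler_sum => i _.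
by rewrite -mulr_suml ler_wpM2r.
Qed.

Lemma stochastic_norm (R : realType) (n : nat) (W : 'M[R]_n) :
  stochastic W -> forall i, \sum_j `|W i j| = 1.
Proof.
by move=> [W0 W1] i; rewrite -(W1 i); apply: eq_bigr => j _; rewrite ger0_norm.
Qed.

(** * The fixed-point equation of the influence vector and its stability *)

Section Influence.
Variables (R : realType) (alpha : R) (n : nat).
Hypothesis alpha01 : 0 < alpha < 1.
Implicit Types (U W : 'M[R]_n).

Let a_gt0 : 0 < alpha. Proof. by case/andP: alpha01. Qed.
Let b_ge0 : 0 <= 1 - alpha. Proof. by case/andP: alpha01; lra. Qed.

(** A priori estimate behind invertibility, the norm bound and stability: the triangle inequality
    leaves a term [(1 - alpha) * norm1 x] on the right, which the left side absorbs. *)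
Lemma norm1_resolvent W (c x : 'cV[R]_n) : stochastic W ->
  x = c + (1 - alpha) *: (W^T *m x) -> alpha * norm1 x <= norm1 c.
Proof.
move=> sW xE.
have : norm1 x <= norm1 c + (1 - alpha) * norm1 x.
  rewrite {1}xE (le_trans (ler_norm1D _ _))// lerD2l norm1Z.
  rewrite ger0_norm// ler_wpM2l//.
  rewrite -[leRHS]mul1r ler_norm1_trmul// => i.
  by rewrite stochastic_norm.
by rewrite mulrBl mul1r; lra.
Qed.

(** A kernel vector solves the fixed-point equation with [c = 0], so the a priori estimate kills
    it. *)
Lemma resolvent_unitmx W : stochastic W ->
  1%:M - (1 - alpha) *: W^T \in unitmx.
Proof.
move=> sW; rewrite -unitmx_tr -row_free_unit; apply: inj_row_free => v v0.
apply: trmx_inj; rewrite trmx0; apply: norm1_eq0.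
rewrite -(ler_pM2l a_gt0) mulr0 -[leRHS](_ : norm1 (0 : 'cV[R]_n) = 0).
  apply: norm1_resolvent (sW) _; rewrite add0r.
  apply/eqP; rewrite -subr_eq0 scalemxAl -{1}[v^T]mul1mx -mulmxBl.
  by rewrite -[X in X *m _]trmxK -trmx_mul v0 trmx0.
by rewrite /norm1 big1// => i _; rewrite mxE normr0.
Qed.

Lemma influenceE W : stochastic W ->
  influence alpha W =
    const_mx (alpha / n%:R) + (1 - alpha) *: (W^T *m influence alpha W).
Proof.
move=> sW; apply/eqP; rewrite -subr_eq scalemxAl.
rewrite -{1}[influence _ _]mul1mx -mulmxBl /influence -scalemxAr mulKVmx.
  by apply/eqP/colP => i; rewrite !mxE mulr1.
exact: resolvent_unitmx.
Qed.

Lemma influence_sumE W : stochastic W -> forall i,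
  influence alpha W i 0 =
    alpha / n%:R + (1 - alpha) * \sum_j W j i * influence alpha W j 0.
Proof.
move=> sW i; rewrite {1}influenceE// !mxE; congr (_ + _ * _).
by apply: eq_bigr => j _; rewrite mxE.
Qed.

Lemma norm1_influence W : stochastic W -> norm1 (influence alpha W) <= 1.
Proof.
move=> sW; rewrite -(ler_pM2l a_gt0) mulr1.
rewrite (le_trans (norm1_resolvent sW (influenceE sW)))//.
rewrite /norm1; under eq_bigr do rewrite mxE.
rewrite sumr_const card_ord ger0_norm; last by rewrite divr_ge0// ltW.
(* For [n = 0] the sum is empty; otherwise the source has l1 norm exactly [alpha]. *)
case: n => [|k]; first by rewrite mulr0n ltW.
by rewrite -[leLHS]mulr_natr divfK.
Qed.

(** Subtracting the two equations shows that the difference solves the equation of [W] with source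
    [(1 - alpha) (U - W)^T v_U], whose l1 norm is at most [(1 - alpha) * B] because [v_U] has l1
    norm at most 1. *)
Lemma influence_perturbation U W (B : R) : stochastic U -> stochastic W ->
  0 <= B -> (forall i, \sum_j `|U i j - W i j| <= B) ->
  norm1 (influence alpha U - influence alpha W) <= (1 - alpha) / alpha * B.
Proof.
move=> sU sW B0 UWB.
have dE : influence alpha U - influence alpha W =
    (1 - alpha) *: ((U - W)^T *m influence alpha U)
    + (1 - alpha) *: (W^T *m (influence alpha U - influence alpha W)).
  rewrite {1}(influenceE sU) {1}(influenceE sW) -scalerDr.
  rewrite linearB/= mulmxBl mulmxBr addrA subrK scalerBr.
  by rewrite opprD addrACA subrr add0r.
have := norm1_resolvent sW dE; set d := norm1 _.
rewrite norm1Z ger0_norm// => dle.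
rewrite mulrAC ler_pdivlMr// mulrC (le_trans dle)// ler_wpM2l//.
rewrite (@le_trans _ _ (B * norm1 (influence alpha U)))//.
  apply: ler_norm1_trmul => i.
  by under eq_bigr do rewrite !mxE; exact: UWB.
by rewrite -[leRHS]mulr1 ler_wpM2l// norm1_influence.
Qed.

End Influence.

(** * Comparing lp norms with the l1 norm and with coordinates *)

Section LpNorm.
Variables (R : realType) (p : R) (n : nat).
Hypothesis p1 : 1 <= p.
Implicit Types v : 'cV[R]_n.

Let p_gt0 : 0 < p. Proof. exact: lt_le_trans p1. Qed.

Lemma lpnorm_le_norm1 v : lpnorm p v <= norm1 v.
Proof.
have s0 := norm1_ge0 v.
rewrite -[leRHS]powRr1// -(mulfV (lt0r_neq0 p_gt0)) powRrM.
apply: ge0_ler_powR; rewrite ?nnegrE ?invr_ge0 ?powR_ge0 ?(ltW p_gt0)//.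
  by apply: sumr_ge0 => i _; exact: powR_ge0.
(* With [s = norm1 v], each [|v_i|^p] is at most [|v_i| s^(p-1)], and these sum to [s^p]. *)
rewrite -[leRHS]mulr_powRB1// /norm1 mulr_suml; apply: ler_sum => i _.
rewrite -[leLHS]mulr_powRB1// ler_wpM2l//.
apply: ge0_ler_powR; rewrite ?nnegrE ?subr_ge0//.
by rewrite (bigD1 i)//= lerDl sumr_ge0.
Qed.

Lemma coord_le_lpnorm v i : `|v i 0| <= lpnorm p v.
Proof.
rewrite -[leLHS]powRr1// -(mulfV (lt0r_neq0 p_gt0)) powRrM.
apply: ge0_ler_powR; rewrite ?nnegrE ?invr_ge0 ?powR_ge0 ?(ltW p_gt0)//.
  by apply: sumr_ge0 => j _; exact: powR_ge0.
by rewrite [leRHS](bigD1 i)//= lerDl sumr_ge0// => j _; exact: powR_ge0.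
Qed.

End LpNorm.

(** Near a nonzero point the function is [expR (p * ln |y|)]; at 0, where this formula breaks down,
    [|y| <= e^(1/p)] forces [|y|^p <= e]. *)
Lemma continuous_norm_powR (R : realType) (p : R) : 0 < p ->
  continuous (fun x : R => `|x| `^ p).
Proof.
move=> p0 x; have [->|x0] := eqVneq x 0.
  rewrite /continuous_at normr0 powR0 ?gt_eqF//.
  apply/cvgr0Pnorm_le => e e0; near=> y.
  rewrite ger0_norm ?powR_ge0//.
  rewrite -[leRHS]powRr1 ?(ltW e0)// -(mulVf (lt0r_neq0 p0)) powRrM.
  apply: ge0_ler_powR; rewrite ?nnegrE ?powR_ge0 ?(ltW p0)//.
  near: y; apply: cvgr0_norm_le; first exact: cvg_id.
  exact: powR_gt0.
rewrite /continuous_at {2}/powR normr_eq0 (negPf x0).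
apply: (@cvg_trans _ ((expR (p * ln `|y|)) @[y --> x])).
  apply: near_eq_cvg; near=> y; rewrite /powR normr_eq0 ifF//.
  apply/negbTE; near: y; apply: (@cvgr_neq0 _ R^o _ (nbhs x) _ idfun x) => //.
apply: (@continuous_comp _ _ _ (fun y : R => p * ln `|y|) expR);
  last exact: continuous_expR.
apply: (@continuousM _ _ (cst p) (fun y : R => ln `|y|)).
  exact: cst_continuous.
apply: (@continuous_comp _ _ _ (fun y : R => `|y|) (@ln R)).
  exact: norm_continuous.
by apply: continuous_ln; rewrite normr_gt0.
Unshelve. all: by end_near. Qed.

(* The amounts are eliminated from [observation]: any such pair is realized by
   [II = 1] and [X = (1 - delta) U]. *)
Definition linkage_pair (R : realType) (delta : R) (n : nat) (W U : 'M[R]_n) :=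
  [/\ linkage_matrix W, stochastic U
    & forall i j, (1 - delta) * U i j <= W i j].

Lemma linkage_stochastic (R : realType) (n : nat) (W : 'M[R]_n) :
  linkage_matrix W -> stochastic W.
Proof. by case. Qed.

(** * From observed amounts to pairs of matrices *)

Section LinkagePairs.
Variables (R : realType) (delta : R) (n : nat).
Hypothesis delta01 : 0 <= delta < 1.
Implicit Types W U : 'M[R]_n.

Let d_lt1 : delta < 1. Proof. by case/andP: delta01. Qed.

(** Chain [(1 - delta) X_ij <= W_ij (1 - delta) II_i <= W_ij * \sum_k X_ik] and divide by the row
    sum of [X]. *)
Lemma observed_linkage_pair W II X : linkage_matrix W ->
  observation delta W II X -> linkage_pair delta W (observed_linkages X).
Proof.
move=> lW [II0 X0 Xd].
have s0 i : 0 < \sum_k X i k.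
  by apply: lt_le_trans (Xd i); rewrite mulr_gt0// subr_gt0.
split=> //.
  split=> [i j|i].
    by rewrite mxE divr_ge0// ?(ltW (s0 i))//; case/andP: (X0 i j).
  under eq_bigr do rewrite mxE.
  by rewrite -mulr_suml divff// gt_eqF.
move=> i j; rewrite mxE mulrA ler_pdivrMr//.
have [/andP[x0 xw] w0] : 0 <= X i j <= W i j * II i /\ 0 <= W i j.
  by split=> //; case: lW.
apply: (@le_trans _ _ (W i j * ((1 - delta) * II i))); last exact: ler_wpM2l.
by rewrite mulrCA ler_wpM2l// subr_ge0 ltW.
Qed.

Lemma linkage_pair_observed W U : linkage_pair delta W U ->
  observation delta W (fun=> 1) ((1 - delta) *: U) /\
  observed_linkages ((1 - delta) *: U) = U.
Proof.
move=> [lW [U0 U1] UW].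
have sE i : \sum_j ((1 - delta) *: U) i j = 1 - delta.
  by under eq_bigr do rewrite mxE; rewrite -mulr_sumr U1 mulr1.
split.
  split=> [//|i j|i]; last by rewrite sE mulr1.
  by rewrite mxE mulr1 UW andbT mulr_ge0// subr_ge0 ltW.
by apply/matrixP => i j; rewrite !mxE sE mulrAC divff ?mul1r// gt_eqF ?subr_gt0.
Qed.

(** Removes the unbounded amounts, so that the errors range over a compact set of matrix pairs. *)
Lemma influence_errorsE (alpha p : R) :
  influence_errors alpha p n delta =
  [set e | exists W U, linkage_pair delta W U /\
     e = lpnorm p (influence alpha U - influence alpha W)].
Proof.
apply/seteqP; split=> e /=.
  move=> [W [II [X [lW oX ->]]]]; exists W, (observed_linkages X).
  by split=> //; exact: observed_linkage_pair oX.
move=> [W [U [WU ->]]]; have [oX UE] := linkage_pair_observed WU.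
by exists W, (fun=> 1), ((1 - delta) *: U); split; rewrite ?UE//; case: WU.
Qed.

(* As U and W have equal row sums, the row distance is twice the sum of the
   positive parts of [W - U], each at most [W i j - (1 - delta) * U i j]. *)
Lemma linkage_pair_row_dist W U : linkage_pair delta W U ->
  forall i, \sum_j `|U i j - W i j| <= 2 * delta.
Proof.
move=> [[W0 _ W1] [U0 U1] UW] i; have /andP[d0 _] := delta01.
apply: (@le_trans _ _
    (\sum_j (2 * (W i j - (1 - delta) * U i j) + (U i j - W i j)))).
  apply: ler_sum => j _; have := UW i j; have := U0 i j.
  have : 0 <= delta * U i j by rewrite mulr_ge0.
  by rewrite ler_norml; lra.
rewrite big_split/= -mulr_sumr !sumrB -mulr_sumr U1 W1; lra.
Qed.

End LinkagePairs.

(** * Existence of a maximal error by compactness *)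

Section Maximum.
Variables (R : realType) (alpha delta p : R) (n : nat).
Hypotheses (alpha01 : 0 < alpha < 1) (delta01 : 0 <= delta < 1) (p1 : 1 <= p).

(** Matrices are flattened to row vectors so that compactness of cubes in ['rV] applies; [W_] and
    [U_] undo the flattening. *)
Let T : topologicalType := ('rV[R]_(n * n) * 'rV[R]_(n * n))%type.
Let W_ (z : T) : 'M[R]_n := vec_mx z.1.
Let U_ (z : T) : 'M[R]_n := vec_mx z.2.
Let K : set T := [set z | linkage_pair delta (W_ z) (U_ z)].

Let W_continuous i j : continuous (fun z => W_ z i j).
Proof.
move=> z; rewrite /W_.
have -> : (fun z : T => vec_mx z.1 i j) = (fun z => z.1 0 (mxvec_index i j)).
  by apply/funext => w; rewrite mxE.
apply: (@continuous_comp _ _ _ (fun z : T => z.1) (fun v => v 0 _)).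
  exact: cvg_fst.
exact: coord_continuous.
Qed.

Let U_continuous i j : continuous (fun z => U_ z i j).
Proof.
move=> z; rewrite /U_.
have -> : (fun z : T => vec_mx z.2 i j) = (fun z => z.2 0 (mxvec_index i j)).
  by apply/funext => w; rewrite mxE.
apply: (@continuous_comp _ _ _ (fun z : T => z.2) (fun v => v 0 _)).
  exact: cvg_snd.
exact: coord_continuous.
Qed.

Let sum_continuous (f : 'I_n -> T -> R) : (forall i, continuous (f i)) ->
  continuous (fun z => \sum_i f i z).
Proof. by move=> fc; apply: continuous_big => //; exact: add_continuous. Qed.

Let closed_forall (I : Type) (P : I -> set T) : (forall i, closed (P i)) ->
  closed [set z | forall i, P i z].
Proof.
move=> cP; have -> : [set z | forall i, P i z] = \bigcap_(i in setT) P i.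
  by apply/seteqP; split=> z /= Pz i => [_|]; exact: Pz.
exact: closed_bigI.
Qed.

Let closed_ge0 (f : T -> R) : continuous f -> closed [set z | 0 <= f z].
Proof. by move=> /(continuous_closedP f)/(_ _ (@closed_ge _ 0)). Qed.

Let closed_eqc (f : T -> R) (a : R) : continuous f -> closed [set z | f z = a].
Proof. by move=> /(continuous_closedP f)/(_ _ (@closed_eq _ a)). Qed.

Lemma linkage_pair_closed : closed K.
Proof.
have -> : K =
    ([set z | forall i j, 0 <= W_ z i j] `&` [set z | forall i, W_ z i i = 0]
     `&` [set z | forall i, \sum_j W_ z i j = 1])
    `&` ([set z | forall i j, 0 <= U_ z i j]
     `&` [set z | forall i, \sum_j U_ z i j = 1])
    `&` [set z | forall i j, 0 <= W_ z i j - (1 - delta) * U_ z i j].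
  apply/seteqP; split=> z /=.
    by move=> [[? ? ?] [? ?] h]; do !split => //; move=> i j; rewrite subr_ge0.
  move=> [[[[? ?] ?] [? ?]] h]; split=> // i j; rewrite -subr_ge0; exact: h.
repeat apply: closedI; apply: closed_forall => i; try apply: closed_forall => j.
- exact: closed_ge0.
- exact: closed_eqc.
- by apply: closed_eqc; apply: sum_continuous.
- exact: closed_ge0.
- by apply: closed_eqc; apply: sum_continuous.
apply: closed_ge0 => z; apply: cvgB; first exact: W_continuous.
by apply: cvgM; [exact: cvg_cst|exact: U_continuous].
Qed.

Let stochastic_le1 (V : 'M[R]_n) i j : stochastic V -> 0 <= V i j <= 1.
Proof.
move=> [V0 V1]; rewrite V0 -(V1 i) (bigD1 j)//= lerDl sumr_ge0//.
Qed.

Lemma linkage_pair_compact : compact K.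
Proof.
pose cube :=
  [set v : 'rV[R]_(n * n) | forall k, `[0 : R, 1]%classic (v ord0 k)].
have ccube : compact cube.
  apply: (@rV_compact R _ (fun=> `[0, 1]%classic)) => _; exact: segment_compact.
apply: (subclosed_compact linkage_pair_closed (compact_setX ccube ccube)).
move=> z [lW sU _]; split=> k; case/mxvec_indexP: k => i j /=.
  by have := stochastic_le1 i j (linkage_stochastic lW); rewrite mxE in_itv.
by have := stochastic_le1 i j sU; rewrite mxE in_itv.
Qed.

(** Continuity comes from the perturbation bound rather than from [invmx]. That bound needs
    stochastic matrices, hence the filter relative to [K]. *)
Let influence_cvg (V : T -> 'M[R]_n) (z : T) (i : 'I_n) :
  (forall w, K w -> stochastic (V w)) -> K z ->
  (forall i j, continuous (fun w => V w i j)) ->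
  influence alpha (V w) i 0 @[w --> within K (nbhs z)] -->
    influence alpha (V z) i 0.
Proof.
move=> sV Kz cV.
have FK : Filter (within K (nbhs z)) by exact: within_filter.
apply/(subr_cvg0 (FF := FK)); apply: (norm_cvg0 (FF := FK)).
(* Summing over all rows dominates every single row distance and stays continuous. *)
pose B w := (1 - alpha) / alpha * \sum_k \sum_j `|V w k j - V z k j|.
have vB : \forall w \near within K (nbhs z),
    0 <= `|influence alpha (V w) i 0 - influence alpha (V z) i 0| <= B w.
  near=> w; have Kw : K w by near: w; exact: withinT.
  rewrite normr_ge0/=; apply: (@le_trans _ _
    (norm1 (influence alpha (V w) - influence alpha (V z)))).
    by rewrite /norm1 (bigD1 i)//= !mxE lerDl sumr_ge0.
  apply: influence_perturbation => //; [exact: sV|exact: sV| |].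
    by apply: sumr_ge0 => k _; exact: sumr_ge0.
  move=> k; rewrite [leRHS](bigD1 k)//= lerDl sumr_ge0// => l _.
  exact: sumr_ge0.
suff cB : B w @[w --> within K (nbhs z)] --> 0.
  have c0 : (0 : R) @[_ --> within K (nbhs z)] --> (0 : R) by exact: cvg_cst.
  exact: (squeeze_cvgr vB c0 cB).
have Bz : B z = 0.
  rewrite /B big1 ?mulr0// => k _; rewrite big1// => j _.
  by rewrite subrr normr0.
apply: (@cvg_within_filter _ _ _ (nbhs z)).
suff : B w @[w --> z] --> B z by rewrite Bz.
apply: (@cvgM _ _ (nbhs z) _ (fun=> (1 - alpha) / alpha)
  (fun w => \sum_k \sum_j `|V w k j - V z k j|)); first exact: cvg_cst.
apply: (@sum_continuous (fun k w => \sum_j `|V w k j - V z k j|)) => k.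
apply: sum_continuous => j w.
apply: (@continuous_comp _ _ _ (fun w => V w k j - V z k j)
  (fun x : R => `|x|)).
  by apply: cvgB; [exact: cV|exact: cvg_cst].
exact: norm_continuous.
Unshelve. all: by end_near. Qed.

(** A linkage matrix must be supplied because none exists for [n = 1]: the only entry would be both
    0 and 1. *)
Lemma influence_errors_max : (exists W : 'M[R]_n, linkage_matrix W) ->
  exists m, is_maximum (influence_errors alpha p n delta) m.
Proof.
move=> [W lW]; have p0 : 0 < p by exact: lt_le_trans p1.
pose d (z : T) := influence alpha (U_ z) - influence alpha (W_ z).
(* The outer root is dropped: it is monotone, so a maximizer of [f] also maximizes the norm. *)
pose f (z : T) : R := \sum_i `|d z i 0| `^ p.
have cf : {within K, continuous f}.
  apply/subspace_continuousP => z Kz; apply: cvg_big.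
    exact: add_continuous.
  move=> i _.
  have FK : Filter (within K (nbhs z)) by exact: within_filter.
  apply: (@continuous_cvg _ _ _ _ FK (fun w => d w i 0)
    (fun x : R => `|x| `^ p) (d z i 0)).
    exact: continuous_norm_powR.
  have dE w : d w i 0 = influence alpha (U_ w) i 0 - influence alpha (W_ w) i 0.
    by rewrite /d !mxE.
  rewrite dE; under eq_cvg do rewrite dE.
  apply: (@cvgB _ _ _ _ FK); apply: influence_cvg => //.
    by move=> w [].
  by move=> w [/linkage_stochastic].
have K0 : K !=set0.
  (* With no data missing, [U = W] is admissible. *)
  exists (mxvec W, mxvec W); rewrite /K /= /W_ /U_ /= mxvecK.
  split=> //; first exact: linkage_stochastic.
  move=> i j; have [W0 _ _] := lW; have /andP[d0 _] := delta01.
  by rewrite mulrBl mul1r gerBl mulr_ge0.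
have [z Kz zmax] := compact_EVT_max K0 linkage_pair_compact cf.
rewrite inE in Kz; exists (lpnorm p (d z)); split.
  by rewrite influence_errorsE//; exists (W_ z), (U_ z).
move=> e; rewrite influence_errorsE// => -[V [U [VU ->]]].
have := zmax (mxvec V, mxvec U); rewrite inE.
rewrite /f /d /K /= /W_ /U_ /= !mxvecK => /(_ VU) h.
have S0 (v : 'cV[R]_n) : \sum_i `|v i 0| `^ p \in Num.nneg.
  by rewrite nnegrE; apply: sumr_ge0 => i _; exact: powR_ge0.
have ip0 : 0 <= p^-1 by rewrite invr_ge0 ltW.
exact: (ge0_ler_powR ip0 (S0 _) (S0 _) h).
Qed.

End Maximum.

(** * Two hubs: an explicit family with error linear in [delta] *)

Section LowerBound.
Variables (R : realType) (alpha : R) (m : nat).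
Hypothesis alpha01 : 0 < alpha < 1.

(** The share that firm [i] buys from firm 0; the rest will go to firm 1. *)
Definition double_star_weight (t : R) (i : nat) : R :=
  if i is i'.+1 then (if i' is _.+1 then 1 - t else 1) else 0.

(* Firms 0 and 1 buy only from each other, every other firm buys a share
   [1 - t] from firm 0 and [t] from firm 1. *)
Definition double_star (t : R) : 'M[R]_m.+2 :=
  \matrix_(i, j)
    if j : nat is j'.+1 then
      (if j' is _.+1 then 0 else 1 - double_star_weight t i)
    else double_star_weight t i.

Lemma double_star_linkage (t : R) :
  0 <= t <= 1 -> linkage_matrix (double_star t).
Proof.
move=> /andP[t0 t1]; split=> [i j|i|i].
- by rewrite mxE; case: i j => [[|[|i]] ?] [[|[|j]] ?] /=; lra.
- by rewrite mxE; case: i => [[|[|i]] ?] /=; rewrite ?subrr.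
rewrite !big_ord_recl big1 => [|j _]; rewrite !mxE ?lift0//=; lra.
Qed.

(** The missing data are exactly the purchases of the non-hub firms from firm 1, a share [t] of
    their inputs. *)
Lemma double_star_pair (t : R) : 0 <= t < 1 ->
  linkage_pair t (double_star t) (double_star 0).
Proof.
move=> /andP[t0 t1].
have l0 : linkage_matrix (double_star 0) by apply: double_star_linkage; lra.
split; [by apply: double_star_linkage; lra|exact: linkage_stochastic|].
move=> i j; rewrite !mxE.
by case: i j => [[|[|i]] ?] [[|[|j]] ?] /=; lra.
Qed.

Lemma influence_double_star (t : R) : 0 <= t <= 1 ->
  let v := influence alpha (double_star t) in
  let c := alpha / m.+2%:R in
  v 0 0 = c + (1 - alpha) * (v 1 0 + m%:R * ((1 - t) * c)) /\
  v 1 0 = c + (1 - alpha) * (v 0 0 + m%:R * (t * c)).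
Proof.
move=> t01 v c.
have vE i : v i 0 = c + (1 - alpha) * \sum_j double_star t j i * v j 0.
  exact/(influence_sumE alpha01)/linkage_stochastic/double_star_linkage.
(* Nobody buys from a non-hub firm, so only the constant term remains and the system closes on the
   two hubs. *)
have v2 (i : 'I_m) : v (lift ord0 (lift ord0 i)) 0 = c.
  by rewrite vE big1 ?mulr0 ?addr0// => j _; rewrite mxE !lift0 /= mul0r.
have i1 : lift ord0 ord0 = 1 :> 'I_m.+2 by exact/val_inj.
split; rewrite vE; congr (_ + _ * _); rewrite !big_ord_recl i1.
  under eq_bigr do rewrite v2 mxE !lift0 /=.
  by rewrite sumr_const card_ord !mxE /= mul0r add0r mul1r mulr_natl.
under eq_bigr do rewrite v2 mxE !lift0 /= subKr.
by rewrite sumr_const card_ord !mxE /= subr0 subrr mul0r add0r mul1r mulr_natl.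
Qed.

(** With [b = 1 - alpha] and [s = t m alpha / (m + 2)], the hub differences satisfy
    [d0 = b (d1 + s)] and [d1 = b (d0 - s)]. Eliminating [d1] gives
    [(1 - b)(1 + b) d0 = b (1 - b) s], and [1 - b = alpha] cancels. *)
Lemma double_star_influence_diff (t : R) : 0 <= t <= 1 ->
  (2 - alpha) * (influence alpha (double_star 0)
    - influence alpha (double_star t)) 0 0 =
  (1 - alpha) * alpha * t * (m%:R / m.+2%:R).
Proof.
move=> t01; have [] := influence_double_star t01.
have [] := @influence_double_star 0 _; first by rewrite lexx ler01.
have -> (u v : 'cV[R]_m.+2) : (u - v) 0 0 = u 0 0 - v 0 0 by rewrite !mxE.
rewrite !subr0 mul0r mulr0 addr0 mul1r.
move: (influence alpha (double_star 0) 0 0) => u0.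
move: (influence alpha (double_star 0) 1 0) => u1.
move: (influence alpha (double_star t) 0 0) => v0.
move: (influence alpha (double_star t) 1 0) => v1.
move=> eu0 eu1 ev0 ev1.
have a0 : alpha != 0 by case/andP: alpha01 => /lt0r_neq0.
apply: (mulfI a0).
have -> : (1 - alpha) * alpha * t * (m%:R / m.+2%:R) =
    (1 - alpha) * (t * (m%:R * (alpha / m.+2%:R))) by ring.
move: (alpha / _) (m%:R) eu0 eu1 ev0 ev1 => c k eu0 eu1 ev0 ev1.
have d0 : u0 - v0 = (1 - alpha) * (u1 - v1 + t * (k * c)) by lra.
have d1 : u1 - v1 = (1 - alpha) * (u0 - v0 - t * (k * c)) by lra.
by rewrite d1 in d0; lra.
Qed.

End LowerBound.

Theorem theorem3p3 (R : realType) (alpha : R) (halpha : 0 < alpha < 1) :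
  exists D1 K1 D2 K2 : R,
    [/\ 0 < D1 <= 1, 0 < K1, 0 < D2 <= 1, 0 < K2 &
     forall (n : nat) (p : R), (2 <= n)%N -> 1 <= p ->
       exists max_error : R -> R,
         [/\ forall delta, 0 <= delta < 1 ->
               is_maximum (influence_errors alpha p n delta) (max_error delta),
             bigO_with D1 K1 max_error (fun delta => delta)
           & (3 <= n)%N ->
             bigOmega_with D2 K2 max_error (fun delta => delta)]].
Proof.
have /andP[a0 a1] := halpha.
have b0 : 0 < 1 - alpha by lra.
have c0 : 0 < 2 - alpha by lra.
(* The upper constant is the perturbation factor times the 2 of the row distance [2 * delta]; the
   final 3 below comes from [m / (m + 2) >= 1/3] for [m >= 1]. With two firms the swap is the only
   linkage matrix and every error is 0, so the lower bound starts at three. *)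
exists 1, ((1 - alpha) / alpha * 2), 1, ((1 - alpha) * alpha / (2 - alpha) / 3).
split; [by rewrite ltr01 lexx| |by rewrite ltr01 lexx| |].
- by rewrite mulr_gt0// divr_gt0.
- by rewrite !divr_gt0// mulr_gt0.
case=> [//|[//|m]] p _ p1.
have /choice[M HM] : forall delta, exists mx, 0 <= delta < 1 ->
    is_maximum (influence_errors alpha p m.+2 delta) mx.
  (* Outside [[0, 1)] the value 0 is an arbitrary default. *)
  move=> delta; have [d01|//] := pselect (0 <= delta < 1); last by exists 0.
  have [|mx Hmx] := influence_errors_max halpha d01 p1 (n := m.+2).
    by exists (double_star m 0); apply: double_star_linkage; rewrite lexx ler01.
  by exists mx.
exists M; split=> // [delta|m0 delta] /andP[d0 d1].
  have d01 : 0 <= delta < 1 by rewrite (ltW d0).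
  have [+ _] := HM _ d01; rewrite influence_errorsE// => -[W [U [WU ->]]].
  rewrite (le_trans (lpnorm_le_norm1 p1 _))// -[leRHS]mulrA.
  have [/linkage_stochastic sW sU _] := WU.
  apply: influence_perturbation => //; last exact: linkage_pair_row_dist.
  by rewrite mulr_ge0// ltW.
have d01 : 0 <= delta < 1 by rewrite (ltW d0).
have d01' : 0 <= delta <= 1 by rewrite !ltW.
have [_ maxM] := HM _ d01.
pose d :=
  influence alpha (double_star m 0) - influence alpha (double_star m delta).
apply: (@le_trans _ _ (lpnorm p d)); last first.
  apply: maxM; rewrite influence_errorsE//.
  exists (double_star m delta), (double_star m 0); split=> //.
  exact: double_star_pair.
(* The coordinate of hub 0 alone bounds every lp norm from below, which keeps the constant free of
   [p]. *)
apply: le_trans (coord_le_lpnorm p1 d 0); apply: le_trans (ler_norm _).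
rewrite -(ler_pM2l c0) double_star_influence_diff//.
have -> : (2 - alpha) * ((1 - alpha) * alpha / (2 - alpha) / 3 * delta) =
    (1 - alpha) * alpha * delta * 3^-1.
  by field; rewrite gt_eqF.
rewrite ler_wpM2l ?mulr_ge0 ?(ltW b0) ?(ltW a0) ?(ltW d0)//.
rewrite ler_pdivlMr// mulrC ler_pdivrMr// -natrM ler_nat.
by case: m m0 {HM maxM d} => // m _; rewrite mulnC; lia.
Qed.
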